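(* For every $q>1$, $\mathsf{Fish}(q\text{-}\mathsf{LL})>H_0/I_0$, and $\lim_{q\to\infty}\mathsf{Fish}(q\text{-}\mathsf{LL})=H_0/I_0$.
   Context: The sketch $q$-$\mathsf{LL}$ ($q>1$) has state space $\mathbb Z$ and, at cardinality $\lambda>0$, distribution $\psi_\lambda(k)=e^{-\lambda/q^k}-e^{-\lambda/q^{k-1}}$; $X_\lambda\sim\psi_\lambda$. With $H(X_\lambda)=-\sum_k\psi_\lambda(k)\log_2\psi_\lambda(k)$ and $I(\lambda)=\sum_k(\frac{\partial}{\partial\lambda}\psi_\lambda(k))^2/\psi_\lambda(k)$, define $\mathcal{H}=\int_0^1H(X_{q^r})\,dr$, $\mathcal{I}=\int_0^1q^{2r}I(q^r)\,dr$ and $\mathsf{Fish}(q\text{-}\mathsf{LL})=\mathcal H/\mathcal I$. Constants: with $h(x)=-x\ln x-(1-x)\ln(1-x)$ and $g(x)=x^2/(e^x-1)$, $H_0=\frac1{\ln2}\int_{-\infty}^\infty h(e^{-e^w})\,dw$ and $I_0=\int_{-\infty}^\infty g(e^w)\,dw$. *)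

(* Defs.v *)
From Stdlib Require Import Reals ZArith.
From Coquelicot Require Import Coquelicot.
Open Scope R_scope.

Definition psi (q lam : R) (k : Z) : R :=
  exp (- lam / powerRZ q k) - exp (- lam / powerRZ q (k - 1)).

Definition sumZ (f : Z -> R) : R :=
  Series (fun n => f (Z.of_nat n)) + Series (fun n => f (- Z.of_nat (S n))%Z).

Definition log2 (x : R) : R := ln x / ln 2.

Definition Hent (q lam : R) : R :=
  sumZ (fun k => - (psi q lam k * log2 (psi q lam k))).

Definition Ifish (q lam : R) : R :=
  sumZ (fun k => (Derive (fun l => psi q l k) lam) ^ 2 / psi q lam k).

Definition calH (q : R) : R := RInt (fun r => Hent q (Rpower q r)) 0 1.
Definition calI (q : R) : R :=
  RInt (fun r => Rpower q (2 * r) * Ifish q (Rpower q r)) 0 1.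

Definition Fish (q : R) : R := calH q / calI q.

Definition hfun (x : R) : R := - x * ln x - (1 - x) * ln (1 - x).
Definition gfun (x : R) : R := x ^ 2 / (exp x - 1).

Definition H0 : R :=
  / ln 2 * RInt_gen (fun w => hfun (exp (- exp w)))
             (Rbar_locally m_infty) (Rbar_locally p_infty).
Definition I0 : R :=
  RInt_gen (fun w => gfun (exp w)) (Rbar_locally m_infty) (Rbar_locally p_infty).

(* Main.v *)
Require Import Defs.
From Stdlib Require Import Reals ZArith Lra Lia Classical.
From Coquelicot Require Import Coquelicot.
Open Scope R_scope.

(** Summing over [k] and integrating over [r] in [0, 1] unfolds to one integral over
    the line: with [M phi] the integral of [phi (exp w)] over all [w], the quantities
    [ln q * calH q] and [ln q * calI q] are [M] of the contribution of a single cell,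
    as a function of [a = lam / q ^ k].  Put [b = (q - 1) a], [u = 1 / (q - 1)] and
    [p = exp (- a) - exp (- q a)].  Then
      [- p ln p = (a exp (- a) - q a exp (- q a)) + exp (- u b) hfun (exp (- b))],
      [(a exp (- a) - q a exp (- q a)) ^ 2 / p =
         (a ^ 2 exp (- a) - (q a) ^ 2 exp (- q a)) + exp (- u b) gfun b],
    and the differences integrate to [0] because [M] is invariant under dilation.
    Hence [Fish q] is the ratio defining [H0 / I0] with both integrands damped by
    [exp (- u x)].  Since [hfun (exp (- x)) / gfun x] is strictly decreasing, damping
    large [x] strictly increases the ratio of the integrals; and [u] tends to [0] as
    [q] tends to infinity. *)

(** * Integrals over the line *)

Notation is_RInt_line F v :=
  (is_RInt_gen F (Rbar_locally m_infty) (Rbar_locally p_infty) v).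

Lemma exp_le_mono (x y : R) : x <= y -> exp x <= exp y.
Proof.
intros [H|H]; [left; now apply exp_increasing | right; now rewrite H].
Qed.

(** Replaces the product filter by one symmetric cutoff [A]. Continuity makes [F] integrable on
    every segment, so the function [RInt] can stand for the relation [is_RInt]. *)
Lemma is_RInt_lineP (F : R -> R) (v : R) :
  (forall t, continuous F t) ->
  is_RInt_line F v <->
  (forall eps, 0 < eps -> exists A, 0 <= A /\
     forall a b, a < - A -> A < b -> Rabs (RInt F a b - v) < eps).
Proof.
intros cF; split.
- intros H eps He.
  destruct (H (fun y => Rabs (y - v) < eps)) as [Q R HQ HR HH].
  { exists (mkposreal eps He); intros y Hy; exact Hy. }
  destruct HQ as [A1 HA1], HR as [A2 HA2].
  exists (Rmax 0 (Rmax (- A1) A2)); split; [apply Rmax_l|].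
  intros a b Ha Hb.
  pose proof (Rmax_r 0 (Rmax (- A1) A2)).
  pose proof (Rmax_l (- A1) A2). pose proof (Rmax_r (- A1) A2).
  destruct (HH a b) as [y [Hy1 Hy2]]; [apply HA1; lra | apply HA2; lra |].
  simpl in Hy1. rewrite (is_RInt_unique _ _ _ _ Hy1). exact Hy2.
- intros H P [e He].
  destruct (H e (cond_pos e)) as [A [HA0 HA]].
  exists (fun a => a < - A) (fun b => A < b).
  + now exists (- A).
  + now exists A.
  + intros a b Ha Hb. exists (RInt F a b); split.
    * apply (RInt_correct F), ex_RInt_continuous. intros; apply cF.
    * apply He. exact (HA a b Ha Hb).
Qed.

Definition exp_decay (F : R -> R) : Prop :=
  (forall t, continuous F t) /\
  exists C c, 0 <= C /\ 0 < c /\ forall t, Rabs (F t) <= C * exp (- c * Rabs t).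

(** From the explicit primitive; the contribution of [b] is nonpositive and is dropped, which makes
    the bound uniform in [b]. *)
Lemma RInt_exp_tail (C c a b : R) : 0 <= C -> 0 < c -> a <= b ->
  exists v, is_RInt (fun t => C * exp (- c * t)) a b v /\ v <= C / c * exp (- c * a).
Proof.
intros HC Hc Hab.
exists (minus (- (C / c) * exp (- c * b)) (- (C / c) * exp (- c * a))); split.
- apply (is_RInt_derive (fun t => - (C / c) * exp (- c * t))).
  + intros x _. auto_derive; [easy | field; lra].
  + intros x _. apply (ex_derive_continuous (V := R_NormedModule)). now auto_derive.
- unfold minus, plus, opp; simpl.
  assert (0 <= C / c * exp (- c * b)); [|lra].
  apply Rmult_le_pos; [|left; apply exp_pos].
  apply Rmult_le_pos; [easy | left; now apply Rinv_0_lt_compat].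
Qed.

Lemma RInt_tail_r (F : R -> R) (C c a b : R) :
  (forall t, continuous F t) -> 0 <= C -> 0 < c ->
  (forall t, Rabs (F t) <= C * exp (- c * Rabs t)) -> 0 <= a -> a <= b ->
  Rabs (RInt F a b) <= C / c * exp (- c * a).
Proof.
intros cF HC Hc HF Ha Hab.
destruct (RInt_exp_tail C c a b HC Hc Hab) as [v [Hv Hle]].
eapply Rle_trans; [|exact Hle].
apply (norm_RInt_le F (fun t => C * exp (- c * t)) a b); trivial.
- intros t Ht. rewrite <- (Rabs_pos_eq t) at 2 by lra. apply HF.
- apply (RInt_correct F), ex_RInt_continuous. intros; apply cF.
Qed.

Lemma RInt_reflect (F : R -> R) (a b : R) : (forall t, continuous F t) ->
  RInt F (- b) (- a) = RInt (fun t => F (- t)) a b.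
Proof.
intros cF.
assert (H := RInt_comp_lin F (-1) 0 a b).
replace (-1 * a + 0) with (- a) in H by ring.
replace (-1 * b + 0) with (- b) in H by ring.
rewrite <- opp_RInt_swap, <- H.
- rewrite <- RInt_opp.
  + apply RInt_ext. intros t _. unfold opp, scal; simpl; unfold mult; simpl.
    replace (-1 * t + 0) with (- t) by ring. ring.
  + apply (ex_RInt_continuous (V := R_CompleteNormedModule)). intros t _.
    apply (continuous_scal_r (V := R_NormedModule) (-1) (fun t => F (-1 * t + 0))).
    apply (continuous_comp (fun t => -1 * t + 0) F); [|apply cF].
    apply (ex_derive_continuous (V := R_NormedModule)). now auto_derive.
- apply ex_RInt_continuous. intros; apply cF.
- apply ex_RInt_continuous. intros; apply cF.
Qed.

Lemma RInt_tail_l (F : R -> R) (C c a b : R) :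
  (forall t, continuous F t) -> 0 <= C -> 0 < c ->
  (forall t, Rabs (F t) <= C * exp (- c * Rabs t)) -> 0 <= a -> a <= b ->
  Rabs (RInt F (- b) (- a)) <= C / c * exp (- c * a).
Proof.
intros cF HC Hc HF Ha Hab.
rewrite RInt_reflect by easy.
apply RInt_tail_r; trivial.
- intros t. apply (continuous_comp Ropp F); [|apply cF].
  apply (ex_derive_continuous (V := R_NormedModule)). now auto_derive.
- intros t. rewrite <- (Rabs_Ropp t). apply HF.
Qed.

Lemma RInt_cont_Chasles (F : R -> R) (a b c : R) : (forall t, continuous F t) ->
  RInt F a c = RInt F a b + RInt F b c.
Proof.
intros cF. symmetry. apply (RInt_Chasles F).
- apply ex_RInt_continuous. intros; apply cF.
- apply ex_RInt_continuous. intros; apply cF.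
Qed.

Lemma exp_small (K c eps : R) : 0 <= K -> 0 < c -> 0 < eps ->
  exists A, 0 <= A /\ K * exp (- c * A) < eps.
Proof.
intros HK Hc He.
(* With this choice [c * A = K / eps], and [exp (K / eps) >= 1 + K / eps > K / eps]. *)
exists (K / (c * eps)).
assert (HA : 0 <= K / (c * eps)).
{ apply Rmult_le_pos; [easy|]. left. apply Rinv_0_lt_compat. now apply Rmult_lt_0_compat. }
split; [easy|].
replace (- c * (K / (c * eps))) with (- (K / eps)) by (field; lra).
rewrite exp_Ropp.
assert (HKe : 0 <= K / eps).
{ apply Rmult_le_pos; [easy|]. left. now apply Rinv_0_lt_compat. }
pose proof (exp_ineq1_le (K / eps)).
apply (Rmult_lt_reg_r (exp (K / eps))); [apply exp_pos|].
rewrite Rmult_assoc, Rinv_l, Rmult_1_r by (apply Rgt_not_eq, exp_pos).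
apply Rlt_le_trans with (eps * (1 + K / eps)).
- replace (eps * (1 + K / eps)) with (eps + K) by (field; lra). lra.
- apply Rmult_le_compat_l; lra.
Qed.

(** Cauchy criterion: the integrals over two segments containing [[- A, A]] differ by four tails,
    each at most [K * exp (- c * A)]; hence the factor 4. *)
Lemma exp_decay_integrable (F : R -> R) : exp_decay F -> exists v : R, is_RInt_line F v.
Proof.
intros [cF [C [c [HC [Hc HF]]]]].
set (K := C / c).
assert (HK : 0 <= K).
{ apply Rmult_le_pos; [easy|]. left. now apply Rinv_0_lt_compat. }
set (FF := filter_prod (Rbar_locally m_infty) (Rbar_locally p_infty)).
destruct (proj1 (filterlim_locally_cauchy (F := FF)
   (fun ab : R * R => RInt F (fst ab) (snd ab)))) as [v Hv].
- intros eps.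
  destruct (exp_small (4 * K) c eps) as [A [HA0 HA]]; [lra | easy | apply cond_pos |].
  exists (fun ab => fst ab < - A /\ A < snd ab); split.
  + exists (fun a => a < - A) (fun b => A < b).
    * now exists (- A).
    * now exists A.
    * now intros.
  + assert (T : forall x, A < x -> Rabs (RInt F A x) <= K * exp (- c * A) /\
                                   Rabs (RInt F (- x) (- A)) <= K * exp (- c * A)).
    { intros x Hx; split; [apply RInt_tail_r | apply RInt_tail_l]; trivial; lra. }
    intros [a b] [a' b'] [Ha Hb] [Ha' Hb']; simpl in *.
    change (Rabs (RInt F a' b' - RInt F a b) < eps).
    destruct (T b Hb) as [T1 _], (T b' Hb') as [T2 _].
    destruct (T (- a) ltac:(lra)) as [_ T3], (T (- a') ltac:(lra)) as [_ T4].
    rewrite Ropp_involutive in T3, T4.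
    rewrite (RInt_cont_Chasles F a (-A) b), (RInt_cont_Chasles F (-A) A b),
      (RInt_cont_Chasles F a' (-A) b'), (RInt_cont_Chasles F (-A) A b') by easy.
    revert T1 T2 T3 T4 HA. unfold Rabs. repeat destruct Rcase_abs; lra.
- exists v. apply is_RInt_lineP; [easy|]. intros eps He.
  destruct (Hv (fun y => Rabs (y - v) < eps)) as [Q R HQ HR HH].
  { exists (mkposreal eps He); intros y Hy; exact Hy. }
  destruct HQ as [A1 HA1], HR as [A2 HA2].
  exists (Rmax 0 (Rmax (- A1) A2)); split; [apply Rmax_l|].
  intros a b Ha Hb.
  pose proof (Rmax_r 0 (Rmax (- A1) A2)).
  pose proof (Rmax_l (- A1) A2). pose proof (Rmax_r (- A1) A2).
  apply (HH a b); [apply HA1; lra | apply HA2; lra].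
Qed.

Lemma is_RInt_line_affine (F : R -> R) (s d v : R) : 0 < s ->
  is_RInt_line F v -> is_RInt_line (fun t => F (s * t + d)) (v / s).
Proof.
intros Hs H.
assert (H1 : is_RInt_line (fun t => scal s (F (s * t + d))) v).
{ intros P HP. destruct (H P HP) as [Q R [A HA] [B HB] HH].
  exists (fun t => Q (s * t + d)) (fun t => R (s * t + d)).
  - exists ((A - d) / s). intros x Hx. apply HA.
    apply (Rmult_lt_compat_l s) in Hx; [|easy].
    replace (s * ((A - d) / s)) with (A - d) in Hx by (field; lra). lra.
  - exists ((B - d) / s). intros x Hx. apply HB.
    apply (Rmult_lt_compat_l s) in Hx; [|easy].
    replace (s * ((B - d) / s)) with (B - d) in Hx by (field; lra). lra.
  - intros x y Hx Hy. destruct (HH _ _ Hx Hy) as [z [Hz Pz]].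
    exists z; split; [exact (is_RInt_comp_lin F s d x y z Hz) | exact Pz]. }
apply (is_RInt_gen_scal _ (/ s)) in H1.
replace (v / s) with (scal (/ s) v) by (unfold scal; simpl; unfold mult; simpl; field; lra).
eapply is_RInt_gen_ext; [|exact H1].
apply filter_forall. intros ab x _. unfold scal; simpl; unfold mult; simpl. field; lra.
Qed.

(** Integrals over segments containing [[a, b]] are at least [RInt F a b > 0]; taking this number as
    the tolerance in the limit forces [v > 0]. *)
Lemma is_RInt_line_pos (F : R -> R) (a b v : R) : (forall t, continuous F t) ->
  (forall t, 0 <= F t) -> a < b -> (forall t, a < t < b -> 0 < F t) ->
  is_RInt_line F v -> 0 < v.
Proof.
intros cF F0 Hab Fpos H.
assert (E : forall x y, ex_RInt F x y).
{ intros. apply (ex_RInt_continuous (V := R_CompleteNormedModule)). intros; apply cF. }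
assert (I : 0 < RInt F a b).
{ apply RInt_gt_0; trivial; intros; apply cF. }
destruct (proj1 (is_RInt_lineP F v cF) H _ I) as [A [HA0 HA]].
set (B := A + 1 + Rabs a + Rabs b).
pose proof (Rabs_pos a). pose proof (Rabs_pos b).
pose proof (Rle_abs a). pose proof (Rle_abs b).
pose proof (Rle_abs (- a)). pose proof (Rle_abs (- b)).
rewrite Rabs_Ropp in *.
specialize (HA (- B) B ltac:(unfold B; lra) ltac:(unfold B; lra)).
rewrite (RInt_cont_Chasles F (-B) a B), (RInt_cont_Chasles F a b B) in HA by easy.
assert (0 <= RInt F (- B) a) by (apply RInt_ge_0; auto; unfold B; lra).
assert (0 <= RInt F b B) by (apply RInt_ge_0; auto; unfold B; lra).
revert HA. unfold Rabs. destruct Rcase_abs; lra.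
Qed.

(** * Integrating series and sums over integer translates *)

(** Weierstrass M-test: the tails of [m] bound the remainders uniformly, so sum and integral can be
    exchanged. *)
Lemma is_RInt_Series_Mtest (u : nat -> R -> R) (m : nat -> R) (a b l : R) : a <= b ->
  (forall n, ex_RInt (u n) a b) ->
  (forall n r, a <= r <= b -> Rabs (u n r) <= m n) -> ex_series m ->
  is_lim_seq (fun N => sum_n (fun n => RInt (u n) a b) N) l ->
  is_RInt (fun r => Series (fun n => u n r)) a b l.
Proof.
intros Hab Hu Hm Sm Hl.
(* [filterlim_RInt] asks for uniform convergence on all of [R], but [m] dominates only on [[a, b]];
   the argument is therefore clamped to [[a, b]]. *)
set (cl := fun r => Rmax a (Rmin b r)).
assert (Hcl : forall r, a <= cl r <= b).
{ intros r. unfold cl, Rmax, Rmin. repeat destruct Rle_dec; lra. }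
assert (Hid : forall r, a <= r <= b -> cl r = r).
{ intros r Hr. unfold cl, Rmax, Rmin. repeat destruct Rle_dec; lra. }
assert (Habs : forall r, ex_series (fun n => Rabs (u n (cl r)))).
{ intros r. apply (ex_series_le (K := R_AbsRing) (V := R_CompleteNormedModule) _ m); [|easy].
  intros n. unfold norm; simpl; unfold abs; simpl. rewrite Rabs_Rabsolu. now apply Hm. }
destruct (filterlim_RInt (fun N r => sum_n (fun n => u n (cl r)) N) a b eventually
  eventually_filter (fun r => Series (fun n => u n (cl r)))
  (fun N => sum_n (fun n => RInt (u n) a b) N)) as [If [L1 L2]].
- intros N.
  apply (is_RInt_ext (fun r => sum_n (fun n => u n r) N)).
  { intros r. rewrite Rmin_left, Rmax_right by easy. intros Hr.
    apply sum_n_ext. intros n. rewrite Hid; [easy | lra]. }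
  induction N as [|N IH].
  + rewrite sum_O. eapply is_RInt_ext; [|apply (RInt_correct (V := R_CompleteNormedModule)), Hu].
    intros r _. simpl. now rewrite sum_O.
  + rewrite sum_Sn. eapply is_RInt_ext.
    2: apply (is_RInt_plus (V := R_NormedModule));
      [exact IH | apply (RInt_correct (V := R_CompleteNormedModule)), Hu].
    intros r _. simpl. now rewrite sum_Sn.
- apply filterlim_locally. intros eps.
  pose proof (Series_correct _ Sm) as Hs.
  assert (Hs' : is_lim_seq (sum_n m) (Series m)) by exact Hs.
  apply is_lim_seq_spec in Hs'. destruct (Hs' eps) as [N0 HN0].
  exists N0. intros N HN r.
  change (Rabs (sum_n (fun n => u n (cl r)) N - Series (fun n => u n (cl r))) < eps).
  assert (SN : forall w : nat -> R, ex_series w ->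
     Series w - sum_n w N = Series (fun k => w (S N + k)%nat)).
  { intros w Hw. rewrite (Series_incr_n w (S N)) by (lia || easy).
    rewrite <- sum_n_Reals. cbn [Init.Nat.pred]. lra. }
  specialize (HN0 N HN). rewrite Rabs_minus_sym in HN0 |- *.
  rewrite SN in HN0 by easy. rewrite SN by (apply ex_series_Rabs, Habs).
  assert (Sm' : ex_series (fun k => m (S N + k)%nat)) by (now apply (ex_series_incr_n m (S N))).
  eapply Rle_lt_trans; [|exact HN0].
  eapply Rle_trans; [|apply Rle_abs].
  eapply Rle_trans.
  + apply Series_Rabs. apply (ex_series_incr_n (fun n => Rabs (u n (cl r))) (S N)), Habs.
  + apply Series_le; [|easy]. intros n; split; [apply Rabs_pos | now apply Hm].
- assert (If = l).
  { apply (filterlim_locally_unique (F := eventually)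
      (fun N => sum_n (fun n => RInt (u n) a b) N)); easy. }
  subst If. eapply is_RInt_ext; [|exact L2].
  intros r. rewrite Rmin_left, Rmax_right by easy. intros Hr. simpl.
  apply Series_ext. intros n. rewrite Hid; [easy | lra].
Qed.

Lemma RInt_translate (F : R -> R) (d a b : R) : (forall t, continuous F t) ->
  RInt (fun r => F (r + d)) a b = RInt F (a + d) (b + d).
Proof.
intros cF.
assert (H := RInt_comp_lin F 1 d a b).
rewrite !Rmult_1_l in H. rewrite <- H.
- apply RInt_ext. intros x _. unfold scal; simpl; unfold mult; simpl.
  now rewrite !Rmult_1_l.
- apply ex_RInt_continuous. intros; apply cF.
Qed.

(** The integer translates of [[0, 1]] tile the line, so the partial sums of the integrals telescope
    to integrals over growing segments. The decay of [F] supplies the majorant for the M-test. *)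
Lemma is_RInt_sumZ (F : R -> R) (v : R) : exp_decay F -> is_RInt_line F v ->
  is_RInt (fun r => sumZ (fun k => F (r - IZR k))) 0 1 v.
Proof.
intros [cF [C [c [HC [Hc HF]]]]] Hv.
assert (Ht : forall d t, continuous (fun r => F (r + d)) t).
{ intros d t. apply (continuous_comp (fun r => r + d) F); [|apply cF].
  apply (ex_derive_continuous (V := R_NormedModule)). now auto_derive. }
assert (E : forall d, ex_RInt (fun r => F (r + d)) 0 1).
{ intros d. apply (ex_RInt_continuous (V := R_CompleteNormedModule)).
  intros; apply Ht. }
(* This is [C * exp (- c * (n - 1))]. For [r] in [[0, 1]] both [Rabs (r - n)] and [Rabs (r + n + 1)]
   are at least [n - 1], so one majorant serves both halves of [sumZ]. *)
set (m := fun n => C * exp c * exp (- c) ^ n).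
assert (Sm : ex_series m).
{ apply (ex_series_scal (V := R_NormedModule)), ex_series_geom.
  rewrite Rabs_pos_eq by (left; apply exp_pos).
  rewrite <- exp_0. apply exp_increasing. lra. }
assert (Hm : forall n t, INR n - 1 <= Rabs t -> Rabs (F t) <= m n).
{ intros n t Hn. eapply Rle_trans; [apply HF|]. unfold m.
  rewrite Rmult_assoc. apply Rmult_le_compat_l; [easy|].
  rewrite <- Rpower_pow by apply exp_pos.
    unfold Rpower. rewrite ln_exp, <- exp_plus. apply exp_le_mono.
  assert (c * (INR n - 1) <= c * Rabs t) by (apply Rmult_le_compat_l; lra). lra. }
assert (S1 : forall N, sum_n (fun n => RInt (fun r => F (r + - INR n)) 0 1) N =
   RInt F (- INR N) 1).
{ induction N as [|N IH].
  - rewrite sum_O, RInt_translate by easy. simpl. f_equal; ring.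
  - rewrite sum_Sn, IH, RInt_translate by easy. unfold plus; simpl plus.
    rewrite (RInt_cont_Chasles F (- INR (S N)) (- INR N) 1) by easy.
    rewrite S_INR. replace (0 + - (INR N + 1)) with (- (INR N + 1)) by ring.
    replace (1 + - (INR N + 1)) with (- INR N) by ring. simpl. ring. }
(* The second half of [sumZ] starts at [k = -1], hence at the segment [[1, 2]], adjacent to the
   segments of [S1], which end at 1. *)
assert (S2 : forall N, sum_n (fun n => RInt (fun r => F (r + INR (S n))) 0 1) N =
   RInt F 1 (INR N + 2)).
{ induction N as [|N IH].
  - rewrite sum_O, RInt_translate by easy. simpl. f_equal; ring.
  - rewrite sum_Sn, IH, RInt_translate by easy.
    rewrite (RInt_cont_Chasles F 1 (INR N + 2) (INR (S N) + 2)) by easy.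
    rewrite !S_INR. replace (0 + (INR N + 1 + 1)) with (INR N + 2) by ring.
    replace (1 + (INR N + 1 + 1)) with (INR N + 1 + 2) by ring. reflexivity. }
assert (B : forall d n, (forall r, 0 <= r <= 1 -> INR n - 1 <= Rabs (r + d)) ->
   Rabs (RInt (fun r => F (r + d)) 0 1) <= m n).
{ intros d n Hd. replace (m n) with (scal (1 - 0) (m n))
    by (unfold scal; simpl; unfold mult; simpl; ring).
  apply (norm_RInt_le (fun r => F (r + d)) (fun _ => m n) 0 1); [lra | | |].
  - intros r Hr. now apply Hm, Hd.
  - apply (RInt_correct (fun r => F (r + d))), E.
  - apply (is_RInt_const (V := R_NormedModule)). }
assert (D1 : forall n r, 0 <= r <= 1 -> INR n - 1 <= Rabs (r + - INR n)).
{ intros n r Hr. rewrite <- Rabs_Ropp. eapply Rle_trans; [|apply Rle_abs]. lra. }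
assert (D2 : forall n r, 0 <= r <= 1 -> INR n - 1 <= Rabs (r + INR (S n))).
{ intros n r Hr. eapply Rle_trans; [|apply Rle_abs]. rewrite S_INR. lra. }
assert (L1 : ex_series (fun n => RInt (fun r => F (r + - INR n)) 0 1)).
{ apply (ex_series_le (K := R_AbsRing) (V := R_CompleteNormedModule) _ m); [|easy].
  intros n. apply B, D1. }
assert (L2 : ex_series (fun n => RInt (fun r => F (r + INR (S n))) 0 1)).
{ apply (ex_series_le (K := R_AbsRing) (V := R_CompleteNormedModule) _ m); [|easy].
  intros n. apply B, D2. }
apply Series_correct in L1, L2.
set (l1 := Series _) in L1. set (l2 := Series _) in L2.
assert (Hl : v = l1 + l2).
{ assert (Q1 : is_lim_seq (fun N => RInt F (- INR N) (INR N + 2)) (l1 + l2)).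
  { apply is_lim_seq_ext with (fun N => sum_n (fun n => RInt (fun r => F (r + - INR n)) 0 1) N
      + sum_n (fun n => RInt (fun r => F (r + INR (S n))) 0 1) N).
    - intros N. now rewrite S1, S2, <- RInt_cont_Chasles.
    - now apply is_lim_seq_plus'. }
  assert (Q2 : is_lim_seq (fun N => RInt F (- INR N) (INR N + 2)) v).
  { apply is_lim_seq_spec. intros eps.
    destruct (proj1 (is_RInt_lineP F v cF) Hv eps (cond_pos eps)) as [A [HA0 HA]].
    destruct (nfloor_ex A HA0) as [N0 [_ HN0]].
    exists (S N0). intros N HN. apply le_INR in HN. rewrite S_INR in HN.
    apply HA; lra. }
  apply is_lim_seq_unique in Q1, Q2. rewrite Q1 in Q2. now injection Q2. }
rewrite Hl. apply (is_RInt_plus (V := R_NormedModule)).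
- apply (is_RInt_ext (fun r => Series (fun n => F (r + - INR n)))).
  { intros r _. apply Series_ext. intros n. now rewrite <- INR_IZR_INZ. }
  apply is_RInt_Series_Mtest with m; try lra; try easy.
  intros n r Hr. now apply Hm, D1.
- apply (is_RInt_ext (fun r => Series (fun n => F (r + INR (S n))))).
  { intros r _. apply Series_ext. intros n. rewrite opp_IZR, <- INR_IZR_INZ.
    f_equal; ring. }
  apply is_RInt_Series_Mtest with m; try lra; try easy.
  intros n r Hr. now apply Hm, D2.
Qed.

(** * Dilation-invariant integrals over the half-line *)

Lemma is_RInt_line_ge0 (F : R -> R) (v : R) : (forall t, continuous F t) ->
  (forall t, 0 <= F t) -> is_RInt_line F v -> 0 <= v.
Proof.
intros cF F0 H. destruct (Rle_lt_dec 0 v) as [|Hv]; [easy|].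
destruct (proj1 (is_RInt_lineP F v cF) H (- v) ltac:(lra)) as [A [HA0 HA]].
specialize (HA (- (A + 1)) (A + 1) ltac:(lra) ltac:(lra)).
assert (0 <= RInt F (- (A + 1)) (A + 1)).
{ apply RInt_ge_0; [lra | | auto].
  apply (ex_RInt_continuous (V := R_CompleteNormedModule)). intros; apply cF. }
revert HA. unfold Rabs. destruct Rcase_abs; lra.
Qed.

(* The two bounds amount to [Rabs (phi (exp w)) <= C * exp (- Rabs w / 2)]. *)
Definition tame (phi : R -> R) : Prop :=
  (forall x, 0 < x -> continuous phi x) /\
  exists C, forall x, 0 < x ->
    Rabs (phi x) <= C * sqrt x /\ Rabs (phi x) * sqrt x <= C.

(* The integral of [phi x / x] over the half-line, after the substitution [x = exp w]. *)
Definition Mint (phi : R -> R) : R :=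
  RInt_gen (fun w => phi (exp w)) (Rbar_locally m_infty) (Rbar_locally p_infty).

Lemma tame_exp_decay (phi : R -> R) (s : R) : 0 < s -> tame phi ->
  exp_decay (fun t => phi (exp (s * t))).
Proof.
intros Hs [cp [C HC]]. split.
- intros t. apply (continuous_comp (fun t => exp (s * t)) phi); [|apply cp, exp_pos].
  apply (ex_derive_continuous (V := R_NormedModule)). now auto_derive.
- exists C, (s / 2). split; [|split; [lra|]].
  { destruct (HC 1 Rlt_0_1) as [H _]. rewrite sqrt_1 in H. pose proof (Rabs_pos (phi 1)). lra. }
  intros t. destruct (HC (exp (s * t)) (exp_pos _)) as [H1 H2].
  assert (E : sqrt (exp (s * t)) = exp (s / 2 * t)).
  { apply sqrt_lem_1; try (left; apply exp_pos).
    rewrite <- exp_plus. f_equal. field. }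
  rewrite E in H1, H2. unfold Rabs at 2. destruct Rcase_abs as [Ht|Ht].
  + replace (- (s / 2) * - t) with (s / 2 * t) by ring. exact H1.
  + replace (- (s / 2) * t) with (- (s / 2 * t)) by ring. rewrite exp_Ropp.
    apply (Rmult_le_reg_r (exp (s / 2 * t))); [apply exp_pos|].
    rewrite Rmult_assoc, Rinv_l, Rmult_1_r by (apply Rgt_not_eq, exp_pos). exact H2.
Qed.

Lemma tame_continuous_exp (phi : R -> R) : tame phi ->
  forall t, continuous (fun w => phi (exp w)) t.
Proof.
intros [cp _] t. apply (continuous_comp exp phi); [|apply cp, exp_pos].
apply (ex_derive_continuous (V := R_NormedModule)). now auto_derive.
Qed.

Lemma is_RInt_Mint (phi : R -> R) : tame phi ->
  is_RInt_line (fun w => phi (exp w)) (Mint phi).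
Proof.
intros Hp. destruct (exp_decay_integrable (fun w => phi (exp w))) as [v Hv].
- destruct (tame_exp_decay phi 1 Rlt_0_1 Hp) as [c1 [C [c H]]].
  split; [now apply tame_continuous_exp|].
  exists C, c. destruct H as [H1 [H2 H3]]. repeat split; try easy.
  intros t. rewrite <- (Rmult_1_l t) at 1. apply H3.
- unfold Mint. now rewrite (is_RInt_gen_unique _ _ Hv).
Qed.

Lemma Mint_unique (phi : R -> R) (v : R) :
  is_RInt_line (fun w => phi (exp w)) v -> Mint phi = v.
Proof. intros H. unfold Mint. apply (is_RInt_gen_unique _ _ H). Qed.

Lemma Mint_ext (phi chi : R -> R) : (forall x, 0 < x -> phi x = chi x) ->
  tame phi -> Mint chi = Mint phi.
Proof.
intros E H. apply Mint_unique.
eapply is_RInt_gen_ext; [|apply is_RInt_Mint, H].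
apply filter_forall. intros ab x _. apply E, exp_pos.
Qed.

Lemma tame_le (phi chi : R -> R) : (forall x, 0 < x -> continuous phi x) ->
  (forall x, 0 < x -> Rabs (phi x) <= chi x) -> tame chi -> tame phi.
Proof.
intros cp Hle [_ [C HC]]. split; [easy|]. exists C. intros x Hx.
destruct (HC x Hx) as [H1 H2]. specialize (Hle x Hx).
pose proof (Rle_abs (chi x)). pose proof (sqrt_pos x). split; [lra|].
eapply Rle_trans; [|exact H2]. apply Rmult_le_compat_r; lra.
Qed.

Lemma tame_ext (phi chi : R -> R) : (forall x, 0 < x -> phi x = chi x) ->
  tame phi -> tame chi.
Proof.
intros E [cp [C HC]]. split.
- intros x Hx. apply (continuous_ext_loc chi phi x); [|now apply cp].
  (* The ball of radius [x] about [x] stays inside the half-line, where the two functions agree. *)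
  exists (mkposreal x Hx). intros y Hy. apply E.
  unfold ball in Hy; simpl in Hy; unfold AbsRing_ball, abs, minus, plus, opp in Hy; simpl in Hy.
  revert Hy. unfold Rabs. destruct Rcase_abs; lra.
- exists C. intros x Hx. rewrite <- E by easy. now apply HC.
Qed.

Lemma tame_plus (phi chi : R -> R) : tame phi -> tame chi -> tame (fun x => phi x + chi x).
Proof.
intros [cp [C HC]] [cc [D HD]]. split.
- intros x Hx. apply (continuous_plus phi chi); auto.
- exists (C + D). intros x Hx. destruct (HC x Hx), (HD x Hx).
  pose proof (Rabs_triang (phi x) (chi x)). pose proof (sqrt_pos x). split; [lra|].
  apply Rle_trans with ((Rabs (phi x) + Rabs (chi x)) * sqrt x); [|lra].
  now apply Rmult_le_compat_r.
Qed.

Lemma tame_scal (k : R) (phi : R -> R) : tame phi -> tame (fun x => k * phi x).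
Proof.
intros [cp [C HC]]. split.
- intros x Hx. apply (continuous_scal_r (V := R_NormedModule) k phi); auto.
- exists (Rabs k * C). intros x Hx. destruct (HC x Hx). rewrite Rabs_mult.
  pose proof (Rabs_pos k).
  split; rewrite Rmult_assoc; now apply Rmult_le_compat_l.
Qed.

Lemma Mint_plus (phi chi : R -> R) : tame phi -> tame chi ->
  Mint (fun x => phi x + chi x) = Mint phi + Mint chi.
Proof.
intros H1 H2. apply Mint_unique.
apply (is_RInt_gen_plus (V := R_NormedModule)); now apply is_RInt_Mint.
Qed.

Lemma Mint_scal (k : R) (phi : R -> R) : tame phi ->
  Mint (fun x => k * phi x) = k * Mint phi.
Proof.
intros H. apply Mint_unique.
apply (is_RInt_gen_scal (V := R_NormedModule) _ k); now apply is_RInt_Mint.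
Qed.

Lemma tame_dilate (s : R) (phi : R -> R) : 0 < s -> tame phi -> tame (fun x => phi (s * x)).
Proof.
intros Hs [cp [C HC]]. split.
- intros x Hx. apply (continuous_comp (fun x => s * x) phi).
  + apply (ex_derive_continuous (V := R_NormedModule)). now auto_derive.
  + apply cp. now apply Rmult_lt_0_compat.
- assert (Hr : 0 < sqrt s) by now apply sqrt_lt_R0.
  assert (C0 : 0 <= C).
  { destruct (HC 1 Rlt_0_1) as [H _]. rewrite sqrt_1 in H. pose proof (Rabs_pos (phi 1)). lra. }
  assert (Hi : 0 <= / sqrt s) by (left; now apply Rinv_0_lt_compat).
  exists (C * sqrt s + C * / sqrt s). intros x Hx.
  destruct (HC (s * x)) as [H1 H2]; [now apply Rmult_lt_0_compat|].
  rewrite sqrt_mult_alt in H1, H2 by lra. pose proof (sqrt_pos x). split.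
  + rewrite Rmult_plus_distr_r.
    assert (0 <= C * / sqrt s * sqrt x) by (repeat apply Rmult_le_pos; lra). lra.
  + assert (0 <= C * sqrt s) by (apply Rmult_le_pos; lra).
    enough (Rabs (phi (s * x)) * sqrt x <= C * / sqrt s) by lra.
    apply (Rmult_le_reg_r (sqrt s)); [easy|].
    replace (C * / sqrt s * sqrt s) with C by (field; lra). lra.
Qed.

(** In the variable [w = ln x], dilation by [s] is translation by [ln s]. *)
Lemma Mint_dilate (s : R) (phi : R -> R) : 0 < s -> tame phi ->
  Mint (fun x => phi (s * x)) = Mint phi.
Proof.
intros Hs H. apply Mint_unique.
assert (E := is_RInt_line_affine _ 1 (ln s) _ Rlt_0_1 (is_RInt_Mint phi H)).
rewrite Rdiv_1_r in E. eapply is_RInt_gen_ext; [|exact E].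
apply filter_forall. intros ab x _. cbn beta.
rewrite Rmult_1_l, exp_plus, exp_ln, Rmult_comm by easy. reflexivity.
Qed.

Lemma Mint_ge0 (phi : R -> R) : tame phi -> (forall x, 0 < x -> 0 <= phi x) -> 0 <= Mint phi.
Proof.
intros H H0. apply (is_RInt_line_ge0 (fun w => phi (exp w))).
- now apply tame_continuous_exp.
- intros t. apply H0, exp_pos.
- now apply is_RInt_Mint.
Qed.

Lemma Mint_le (phi chi : R -> R) : tame phi -> tame chi ->
  (forall x, 0 < x -> phi x <= chi x) -> Mint phi <= Mint chi.
Proof.
intros H1 H2 Hle.
assert (H : 0 <= Mint (fun x => chi x + -1 * phi x)).
{ apply Mint_ge0; [now apply tame_plus; [|apply tame_scal]|].
  intros x Hx. specialize (Hle x Hx). lra. }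
rewrite Mint_plus, Mint_scal in H; trivial; [lra | now apply tame_scal].
Qed.

Lemma Mint_gt0 (phi : R -> R) (a b : R) : tame phi -> (forall x, 0 < x -> 0 <= phi x) ->
  0 < a -> a < b -> (forall x, a < x < b -> 0 < phi x) -> 0 < Mint phi.
Proof.
intros H H0 Ha Hab Hp.
apply (is_RInt_line_pos (fun w => phi (exp w)) (ln a) (ln b)).
- now apply tame_continuous_exp.
- intros t. apply H0, exp_pos.
- now apply ln_increasing.
- intros t [T1 T2]. apply Hp. split.
  + rewrite <- (exp_ln a) by easy. now apply exp_increasing.
  + rewrite <- (exp_ln b) by lra. now apply exp_increasing.
- now apply is_RInt_Mint.
Qed.

Lemma Mint_gt0_of_pos (phi : R -> R) : tame phi -> (forall x, 0 < x -> 0 < phi x) ->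
  0 < Mint phi.
Proof.
intros H Hp. apply (Mint_gt0 phi 1 2); try lra; trivial.
- intros; left; auto.
- intros x Hx. apply Hp. lra.
Qed.

(** Unfolding with [t = r - k] gives the integral of [phi (exp (ln q * t))] over the line; the
    substitution [w = ln q * t] produces the factor [1 / ln q]. *)
Lemma RInt_sumZ_geometric (phi : R -> R) (q : R) : 1 < q -> tame phi ->
  RInt (fun r => sumZ (fun k => phi (Rpower q (r - IZR k)))) 0 1 = Mint phi / ln q.
Proof.
intros Hq H. apply (is_RInt_unique (V := R_CompleteNormedModule)).
assert (Hl : 0 < ln q) by (rewrite <- ln_1; apply ln_increasing; lra).
assert (E := is_RInt_line_affine _ (ln q) 0 _ Hl (is_RInt_Mint phi H)).
apply (is_RInt_gen_ext _ (fun t => phi (exp (ln q * t)))) in E.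
2: { apply filter_forall. intros ab x _. now rewrite Rplus_0_r. }
assert (D := tame_exp_decay phi (ln q) Hl H).
apply (is_RInt_ext (fun r => sumZ (fun k => phi (exp (ln q * (r - IZR k)))))).
- intros r _. unfold sumZ, Rpower.
  f_equal; apply Series_ext; intros n; do 2 f_equal; ring.
- exact (is_RInt_sumZ _ _ D E).
Qed.

(** * Exponential damping *)

Definition damp (u : R) (phi : R -> R) (x : R) : R := exp (- u * x) * phi x.

Lemma damp_bounds (u x : R) : 0 <= u -> 0 < x -> 1 - u * x <= exp (- u * x) <= 1.
Proof.
intros Hu Hx. split.
- pose proof (exp_ineq1_le (- u * x)). lra.
- rewrite <- exp_0. apply exp_le_mono.
  assert (0 <= u * x) by (apply Rmult_le_pos; lra). lra.
Qed.

Lemma tame_damp (u : R) (phi : R -> R) : 0 <= u -> tame phi -> tame (damp u phi).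
Proof.
intros Hu [cp [C HC]]. split.
- intros x Hx. apply (continuous_mult (fun x => exp (- u * x)) phi); [|auto].
  apply (ex_derive_continuous (V := R_NormedModule)). now auto_derive.
- exists C. intros x Hx. unfold damp. rewrite Rabs_mult.
  rewrite (Rabs_pos_eq (exp _)) by (left; apply exp_pos).
  destruct (damp_bounds u x Hu Hx) as [_ H]. destruct (HC x Hx) as [H1 H2].
  assert (exp (- u * x) * Rabs (phi x) <= 1 * Rabs (phi x)).
  { apply Rmult_le_compat_r; [apply Rabs_pos | easy]. }
  pose proof (sqrt_pos x). split; [lra|].
  eapply Rle_trans; [|exact H2]. apply Rmult_le_compat_r; lra.
Qed.

(** Since [1 - u x <= exp (- u x) <= 1], damping lowers the integral by at least 0 and at most
    [u * K], where [K] is the integral of [x * phi x]. *)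
Lemma is_lim_Mint_damp (phi : R -> R) : tame phi -> tame (fun x => x * phi x) ->
  (forall x, 0 < x -> 0 <= phi x) ->
  is_lim (fun q => Mint (damp (/ (q - 1)) phi)) p_infty (Mint phi).
Proof.
intros H Hx H0. apply is_lim_spec. intros eps.
set (K := Mint (fun x => x * phi x)).
(* Beyond this bound [q - 1 > K / eps], that is [u * K < eps]; the 1 keeps [q - 1] positive. *)
exists (Rmax 1 (1 + K / eps)). intros q Hq.
pose proof (Rmax_l 1 (1 + K / eps)). pose proof (Rmax_r 1 (1 + K / eps)).
pose proof (cond_pos eps).
assert (Hu : 0 < / (q - 1)) by (apply Rinv_0_lt_compat; lra).
set (u := / (q - 1)) in *.
assert (Td : tame (damp u phi)) by (apply tame_damp; [lra | easy]).
assert (L1 : Mint (damp u phi) <= Mint phi).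
{ apply Mint_le; trivial. intros x Px. unfold damp.
  destruct (damp_bounds u x) as [_ B]; [lra | easy |].
  rewrite <- (Rmult_1_l (phi x)) at 2. apply Rmult_le_compat_r; auto. }
assert (L2 : Mint phi + - u * K <= Mint (damp u phi)).
{ unfold K. rewrite <- Mint_scal, <- Mint_plus; trivial; [|now apply tame_scal].
  apply Mint_le; trivial; [now apply tame_plus; [|apply tame_scal]|].
  intros x Px. unfold damp.
  destruct (damp_bounds u x) as [B _]; [lra | easy |].
  apply (Rmult_le_compat_r (phi x)) in B; auto. lra. }
assert (u * K < eps).
{ unfold u. apply (Rmult_lt_reg_l (q - 1)); [lra|].
  rewrite <- Rmult_assoc, Rinv_r, Rmult_1_l by lra.
  apply (Rmult_lt_reg_r (/ eps)); [now apply Rinv_0_lt_compat|].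
  rewrite Rmult_assoc, Rinv_r by lra. unfold Rdiv in *. lra. }
apply Rabs_def1; lra.
Qed.

(** * Damping and ratios of integrals *)

(** By the intermediate value theorem [phi] keeps the sign of [phi 1], so [phi 1 * phi] is positive
    and has a positive integral. *)
Lemma Mint_neq0 (phi : R -> R) : tame phi -> (forall x, 0 < x -> phi x <> 0) ->
  Mint phi <> 0.
Proof.
intros H Hnz HM.
assert (cF : continuity (fun w => phi (exp w))).
{ intros t. apply continuity_pt_filterlim. now apply (tame_continuous_exp phi). }
assert (Hsame : forall x, 0 < x -> 0 < phi 1 * phi x).
{ intros x Hx.
  destruct (Rlt_le_dec 0 (phi 1 * phi x)) as [|Hle]; [easy|exfalso].
  destruct (IVT_gen (fun w => phi (exp w)) 0 (ln x) 0 cF) as [w [_ Hw]].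
  - rewrite exp_0, exp_ln by easy.
    unfold Rmin, Rmax. repeat destruct Rle_dec; nra.
  - exact (Hnz _ (exp_pos w) Hw). }
pose proof (Mint_gt0_of_pos _ (tame_scal (phi 1) phi H) Hsame) as P.
rewrite Mint_scal, HM in P by easy. lra.
Qed.

(* Damping favours small [x], where [phi / chi] is largest: if [x0] is the point
   at which [phi / chi] equals the ratio [rho] of the integrals, then
   [(exp (- u x) - exp (- u x0)) (phi x - rho * chi x)] is nonnegative. *)
Lemma Mint_damp_ratio (phi chi : R -> R) (u : R) : 0 < u -> tame phi -> tame chi ->
  (forall x, 0 < x -> 0 < chi x) ->
  (forall x y, 0 < x < y -> phi y * chi x < phi x * chi y) ->
  Mint phi / Mint chi < Mint (damp u phi) / Mint (damp u chi).
Proof.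
intros Hu Hp Hc Hpos Hdec.
assert (Mc : 0 < Mint chi) by now apply Mint_gt0_of_pos.
assert (Td : tame (damp u chi)) by (apply tame_damp; [lra | easy]).
assert (Mdc : 0 < Mint (damp u chi)).
{ apply Mint_gt0_of_pos; [easy|].
  intros x Hx. apply Rmult_lt_0_compat; [apply exp_pos | auto]. }
set (rho := Mint phi / Mint chi).
set (D := fun x => phi x + - rho * chi x).
assert (TD : tame D) by (apply tame_plus; [|apply tame_scal]; easy).
assert (MD : Mint D = 0).
{ unfold D. rewrite Mint_plus, Mint_scal; trivial; [|now apply tame_scal].
  unfold rho. field. lra. }
(* The integral of [D] is 0 by the choice of [rho], so [D] must vanish somewhere; this gives the
   crossing point [x0]. *)
destruct (classic (exists x, 0 < x /\ D x = 0)) as [[x0 [Hx0 Z]]|N].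
2: { exfalso. apply (Mint_neq0 D TD); [|easy].
     intros x Hx E. apply N. now exists x. }
assert (Z' : phi x0 = rho * chi x0) by (unfold D in Z; lra).
assert (Dl : forall x, 0 < x < x0 -> 0 < D x).
{ intros x Hx. specialize (Hdec x x0 ltac:(lra)). rewrite Z' in Hdec.
  assert (0 < chi x0) by auto. unfold D. nra. }
assert (Dr : forall x, x0 < x -> D x < 0).
{ intros x Hx. specialize (Hdec x0 x ltac:(lra)). rewrite Z' in Hdec.
  assert (0 < chi x0) by auto. unfold D. nra. }
set (c := exp (- u * x0)).
set (E := fun x => damp u D x + - c * D x).
assert (TdD : tame (damp u D)) by (apply tame_damp; [lra | easy]).
assert (ME : 0 < Mint E).
{ assert (Er : forall x, x0 < x -> 0 < E x).
  { intros x Hx. specialize (Dr x Hx). unfold E, damp.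
    assert (exp (- u * x) < c) by (apply exp_increasing; nra). nra. }
  apply (Mint_gt0 E x0 (x0 + 1)); try lra.
  - apply tame_plus; [|apply tame_scal]; easy.
  - intros x Hx. destruct (Rtotal_order x x0) as [L|[Eq|G]].
    + specialize (Dl x (conj Hx L)). unfold E, damp.
      assert (c < exp (- u * x)) by (apply exp_increasing; nra). nra.
    + subst x. unfold E, damp. rewrite Z. lra.
    + left; auto.
  - intros x Hx. apply Er. lra. }
(* Because [Mint D = 0], the subtracted multiple [c * D] costs nothing, and positivity passes to the
   integral of [damp u D]. *)
unfold E in ME. rewrite Mint_plus, Mint_scal, MD in ME; trivial; [|now apply tame_scal].
assert (Tp : tame (damp u phi)) by (apply tame_damp; [lra | easy]).
rewrite (Mint_ext (fun x => damp u phi x + - rho * damp u chi x)) in ME.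
- rewrite Mint_plus, Mint_scal in ME; trivial; [|now apply tame_scal].
  apply (Rmult_lt_reg_r (Mint (damp u chi))); [easy|].
  unfold Rdiv. rewrite Rmult_assoc, Rinv_l by lra. lra.
- intros x _. unfold damp, D. ring.
- apply tame_plus; [|apply tame_scal]; easy.
Qed.

(** * Growth bounds for the two integrands *)

(** With [N = n + 1], [sqrt x <= N + x <= N * exp (x / N)]; the [n]-th power of the right side is at
    most [N ^ n * exp x]. *)
Lemma sqrt_pow_le_exp (n : nat) : exists K, forall x, 0 < x -> sqrt x ^ n <= K * exp x.
Proof.
set (N := INR (S n)).
assert (HN : 1 <= N) by (unfold N; rewrite S_INR; pose proof (pos_INR n); lra).
exists (N ^ n). intros x Hx.
assert (B : sqrt x <= N * exp (x / N)).
{ pose proof (exp_ineq1_le (x / N)).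
  apply Rle_trans with (N * (1 + x / N)); [|apply Rmult_le_compat_l; lra].
  replace (N * (1 + x / N)) with (N + x) by (field; lra).
  pose proof (sqrt_pos x). pose proof (sqrt_sqrt x ltac:(lra)). nra. }
apply Rle_trans with ((N * exp (x / N)) ^ n).
{ apply pow_incr. split; [apply sqrt_pos | easy]. }
rewrite Rpow_mult_distr. apply Rmult_le_compat_l; [apply pow_le; lra|].
rewrite <- Rpower_pow by apply exp_pos. unfold Rpower. rewrite ln_exp.
apply exp_le_mono.
assert (INR n <= N) by (unfold N; rewrite S_INR; lra).
replace x with (N * (x / N)) at 2 by (field; lra).
apply Rmult_le_compat_r; [|easy].
left. apply Rdiv_lt_0_compat; lra.
Qed.

(** The exponent [S n] makes the function vanish at 0. The cases 0 and 1 are the terms that cancel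
    in the entropy and in the information. *)
Definition powexp (n : nat) (x : R) : R := x ^ S n * exp (- x).

Lemma tame_powexp (n : nat) : tame (powexp n).
Proof.
split.
- intros x _. unfold powexp. apply (ex_derive_continuous (V := R_NormedModule)). now auto_derive.
(* In powers of [sqrt x], dividing [x ^ S n] by [sqrt x] leaves exponent [2 n + 1], and multiplying
   gives [2 n + 3]. *)
- destruct (sqrt_pow_le_exp (2 * n + 1)) as [K HK].
  destruct (sqrt_pow_le_exp (2 * n + 3)) as [L HL].
  exists (Rmax K L). intros x Hx. specialize (HK x Hx). specialize (HL x Hx).
  pose proof (Rmax_l K L). pose proof (Rmax_r K L). pose proof (sqrt_pos x).
  assert (E : x ^ S n = sqrt x * sqrt x ^ (2 * n + 1)).
  { rewrite <- (sqrt_sqrt x) at 1 by lra.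
    rewrite Rpow_mult_distr, <- pow_add.
  replace (S n + S n)%nat with (1 + (2 * n + 1))%nat by lia.
  now rewrite (pow_add _ 1), pow_1. }
  unfold powexp. rewrite Rabs_pos_eq.
  2: { apply Rmult_le_pos; [apply pow_le; lra | left; apply exp_pos]. }
  assert (I : exp x * exp (- x) = 1) by (rewrite <- exp_plus, Rplus_opp_r; apply exp_0).
  pose proof (exp_pos (- x)). split.
  + rewrite E.
    apply Rle_trans with (sqrt x * (K * exp x) * exp (- x)).
    * apply Rmult_le_compat_r; [lra|]. apply Rmult_le_compat_l; lra.
    * replace (sqrt x * (K * exp x) * exp (- x)) with (sqrt x * K * (exp x * exp (- x))) by ring.
      rewrite I. nra.
  + apply Rle_trans with ((L * exp x) * exp (- x)); [|rewrite Rmult_assoc, I; lra].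
    rewrite E.
    replace (sqrt x * sqrt x ^ (2 * n + 1) * exp (- x) * sqrt x)
      with (sqrt x ^ (2 * n + 3) * exp (- x)); [apply Rmult_le_compat_r; lra|].
    replace (2 * n + 3)%nat with (1 + (2 * n + 1) + 1)%nat by lia.
    rewrite !pow_add. simpl. ring.
Qed.

Lemma exp_gt1 (x : R) : 0 < x -> 1 < exp x.
Proof. intros Hx. rewrite <- exp_0. now apply exp_increasing. Qed.

Lemma exp_neg_lt1 (x : R) : 0 < x -> 0 < exp (- x) < 1.
Proof.
intros Hx. split; [apply exp_pos|]. rewrite <- exp_0. apply exp_increasing. lra.
Qed.

Lemma gfun_pos (x : R) : 0 < x -> 0 < gfun x.
Proof.
intros Hx. pose proof (exp_gt1 x Hx). unfold gfun. apply Rdiv_lt_0_compat; [nra | lra].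
Qed.

(** Clearing denominators leaves [x exp x <= (1 + x) (exp x - 1)], which is [1 + x <= exp x]. *)
Lemma gfun_le (x : R) : 0 < x -> gfun x <= powexp 0 x + powexp 1 x.
Proof.
intros Hx. pose proof (exp_gt1 x Hx). unfold gfun, powexp. rewrite exp_Ropp.
apply (Rmult_le_reg_r (exp x * (exp x - 1))); [nra|].
replace (x ^ 2 / (exp x - 1) * (exp x * (exp x - 1))) with (x * (x * exp x)) by (field; lra).
replace ((x ^ 1 * / exp x + x ^ 2 * / exp x) * (exp x * (exp x - 1)))
  with (x * ((1 + x) * (exp x - 1))) by (field; lra).
apply Rmult_le_compat_l; [lra|]. pose proof (exp_ineq1_le x). lra.
Qed.

Lemma continuous_gfun (x : R) : 0 < x -> continuous gfun x.
Proof.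
intros Hx. pose proof (exp_gt1 x Hx).
apply (ex_derive_continuous (V := R_NormedModule)). unfold gfun. auto_derive. lra.
Qed.

Lemma tame_gfun : tame gfun.
Proof.
apply (tame_le _ (fun x => powexp 0 x + powexp 1 x)).
- apply continuous_gfun.
- intros x Hx. rewrite Rabs_pos_eq by (left; now apply gfun_pos). now apply gfun_le.
- apply tame_plus; apply tame_powexp.
Qed.

Lemma tame_id_gfun : tame (fun x => x * gfun x).
Proof.
apply (tame_le _ (fun x => powexp 1 x + powexp 2 x)).
- intros x Hx. apply (continuous_mult (fun x => x) gfun); [apply continuous_id|].
  now apply continuous_gfun.
- intros x Hx. rewrite Rabs_pos_eq.
  2: { apply Rmult_le_pos; [|left; apply gfun_pos]; lra. }
  pose proof (gfun_le x Hx) as H. apply (Rmult_le_compat_l x) in H; [|lra].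
  eapply Rle_trans; [exact H|]. unfold powexp. right. ring.
- apply tame_plus; apply tame_powexp.
Qed.

(** The entropy integrand in the variable [x = exp w], so that [H0] is [/ ln 2 * Mint hexp]. *)
Definition hexp (x : R) : R := hfun (exp (- x)).

Lemma hexpE (x : R) :
  hexp x = x * exp (- x) + - ((1 - exp (- x)) * ln (1 - exp (- x))).
Proof. unfold hexp, hfun. rewrite ln_exp. ring. Qed.

Lemma ln_le_sub1 (z : R) : 0 < z -> ln z <= z - 1.
Proof. intros Hz. pose proof (exp_ineq1_le (ln z)). rewrite exp_ln in H; lra. Qed.

(** The upper bounds are [ln t <= t - 1] at [t = 1 / z] and at [t = 1 / sqrt z]. With
    [z = 1 - exp (- x)] the first controls large [x], the second small [x]. *)
Lemma mul_ln_bounds (z : R) : 0 < z < 1 ->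
  0 < - (z * ln z) /\ - (z * ln z) <= 1 - z /\ - (z * ln z) <= 2 * sqrt z.
Proof.
intros Hz. assert (Hl : ln z < 0) by (rewrite <- ln_1; apply ln_increasing; lra).
split; [nra|]. split.
- pose proof (ln_le_sub1 (/ z) ltac:(apply Rinv_0_lt_compat; lra)) as H.
  rewrite ln_Rinv in H by lra. apply (Rmult_le_compat_l z) in H; [|lra].
  replace (z * (/ z - 1)) with (1 - z) in H by (field; lra). lra.
- assert (Hs : 0 < sqrt z) by (apply sqrt_lt_R0; lra).
  pose proof (ln_le_sub1 (/ sqrt z) ltac:(apply Rinv_0_lt_compat; lra)) as H.
  rewrite ln_Rinv in H by lra.
  assert (E : ln z = 2 * ln (sqrt z)).
  { rewrite <- (sqrt_sqrt z) at 1 by lra. rewrite ln_mult by easy. ring. }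
  apply (Rmult_le_compat_l (2 * z)) in H; [|lra].
  rewrite E.
  replace (2 * z * (/ sqrt z - 1)) with (2 * sqrt z - 2 * z) in H; [lra|].
  rewrite <- (sqrt_sqrt z) at 2 3 by lra. field. lra.
Qed.

Lemma hexp_pos (x : R) : 0 < x -> 0 < hexp x.
Proof.
intros Hx. rewrite hexpE. pose proof (exp_neg_lt1 x Hx).
destruct (mul_ln_bounds (1 - exp (- x))) as [H1 _]; [lra|]. nra.
Qed.

Lemma continuous_hexp (x : R) : 0 < x -> continuous hexp x.
Proof.
intros Hx. pose proof (exp_neg_lt1 x Hx).
apply (ex_derive_continuous (V := R_NormedModule)). unfold hexp, hfun. auto_derive. lra.
Qed.

Lemma tame_hexp : tame hexp.
Proof.
apply (tame_ext (fun x => powexp 0 x + - ((1 - exp (- x)) * ln (1 - exp (- x))))).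
{ intros x _. rewrite hexpE. unfold powexp. ring. }
apply tame_plus; [apply tame_powexp|]. split.
- intros x Hx. pose proof (exp_neg_lt1 x Hx).
  apply (ex_derive_continuous (V := R_NormedModule)). auto_derive. lra.
- destruct (sqrt_pow_le_exp 1) as [K HK]. exists (Rmax 2 K). intros x Hx.
  pose proof (Rmax_l 2 K). pose proof (Rmax_r 2 K).
  specialize (HK x Hx). rewrite pow_1 in HK.
  pose proof (exp_neg_lt1 x Hx). pose proof (exp_ineq1_le (- x)). pose proof (sqrt_pos x).
  destruct (mul_ln_bounds (1 - exp (- x))) as [B1 [B2 B3]]; [lra|].
  rewrite Rabs_pos_eq by lra. split.
  + assert (sqrt (1 - exp (- x)) <= sqrt x) by (apply sqrt_le_1_alt; lra). nra.
  + apply Rle_trans with (exp (- x) * (K * exp x)).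
    * apply Rmult_le_compat; lra.
    * rewrite exp_Ropp. replace (/ exp x * (K * exp x)) with K; [easy|].
      field. apply Rgt_not_eq, exp_pos.
Qed.

Lemma tame_id_hexp : tame (fun x => x * hexp x).
Proof.
apply (tame_le _ (fun x => powexp 1 x + powexp 0 x)).
- intros x Hx. apply (continuous_mult (fun x => x) hexp); [apply continuous_id|].
  now apply continuous_hexp.
- intros x Hx. pose proof (hexp_pos x Hx). pose proof (exp_neg_lt1 x Hx).
  rewrite Rabs_pos_eq by nra. rewrite hexpE.
  destruct (mul_ln_bounds (1 - exp (- x))) as [_ [B _]]; [lra|].
  apply (Rmult_le_compat_l x) in B; [|lra]. unfold powexp. simpl. lra.
- apply tame_plus; apply tame_powexp.
Qed.

(** * Monotonicity of the ratio of the two integrands *)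

(** The derivative has the sign of [(1 + c) exp (- c) - 1], negative because [1 + c < exp c]. *)
Lemma one_minus_exp_div_decr (x y : R) : 0 < x < y ->
  (1 - exp (- y)) / y < (1 - exp (- x)) / x.
Proof.
intros Hxy.
destruct (MVT_cor2 (fun t => (1 - exp (- t)) / t)
  (fun t => (t * exp (- t) - (1 - exp (- t))) / t ^ 2) x y) as [c [Hc1 Hc2]]; [easy | |].
- intros c Hc. apply is_derive_Reals. auto_derive; [lra|]. field; lra.
- assert ((c * exp (- c) - (1 - exp (- c))) / c ^ 2 < 0); [|nra].
  assert (c * exp (- c) - (1 - exp (- c)) < 0).
  { pose proof (exp_ineq1 c ltac:(lra)) as H.
    apply (Rmult_lt_compat_r (exp (- c))) in H; [|apply exp_pos].
    rewrite <- (exp_plus c), Rplus_opp_r, exp_0 in H. lra. }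
  unfold Rdiv. assert (0 < / c ^ 2) by (apply Rinv_0_lt_compat; nra). nra.
Qed.

(** The sign of the derivative comes from [ln z <= z - 1] at [z = 1 / (1 - exp (- c))]. *)
Lemma ln_one_minus_exp_decr (x y : R) : 0 < x < y ->
  - ln (1 - exp (- y)) * exp y <= - ln (1 - exp (- x)) * exp x.
Proof.
intros Hxy.
destruct (MVT_cor2 (fun t => - ln (1 - exp (- t)) * exp t)
  (fun t => exp t * (- ln (1 - exp (- t)) - exp (- t) / (1 - exp (- t)))) x y)
  as [c [Hc1 Hc2]]; [easy | |].
- intros c Hc. pose proof (exp_neg_lt1 c ltac:(lra)).
  apply is_derive_Reals. auto_derive; [lra|]. fold (1 - exp (- c)).
  set (l := ln _). field. lra.
- pose proof (exp_neg_lt1 c ltac:(lra)) as He.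
  pose proof (ln_le_sub1 (/ (1 - exp (- c))) ltac:(apply Rinv_0_lt_compat; lra)) as H.
  rewrite ln_Rinv in H by lra.
  replace (/ (1 - exp (- c)) - 1) with (exp (- c) / (1 - exp (- c))) in H by (field; lra).
  pose proof (exp_pos c).
  assert (exp c * (- ln (1 - exp (- c)) - exp (- c) / (1 - exp (- c))) <= 0) by nra.
  nra.
Qed.

(* With [s x = (1 - exp (- x)) / x] and [L x = - ln (1 - exp (- x)) * exp x],
   the ratio is [s + s ^ 2 * L], and both [s] and [L] are decreasing. *)
Lemma hexp_gfun_ratio_decr (x y : R) : 0 < x < y -> hexp y * gfun x < hexp x * gfun y.
Proof.
intros Hxy.
set (s := fun t => (1 - exp (- t)) / t).
set (L := fun t => - ln (1 - exp (- t)) * exp t).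
assert (E : forall t, 0 < t -> hexp t = (s t + s t ^ 2 * L t) * gfun t).
{ intros t Ht. pose proof (exp_gt1 t Ht). rewrite hexpE. unfold s, L, gfun.
  set (l := ln _). rewrite exp_Ropp. field. lra. }
assert (Lp : forall t, 0 < t -> 0 < L t).
{ intros t Ht. pose proof (exp_neg_lt1 t Ht). apply Rmult_lt_0_compat; [|apply exp_pos].
  assert (ln (1 - exp (- t)) < 0) by (rewrite <- ln_1; apply ln_increasing; lra). lra. }
assert (Sp : forall t, 0 < t -> 0 < s t).
{ intros t Ht. pose proof (exp_neg_lt1 t Ht). apply Rdiv_lt_0_compat; lra. }
pose proof (one_minus_exp_div_decr x y Hxy) as S1. fold (s x) (s y) in S1.
pose proof (ln_one_minus_exp_decr x y Hxy) as L1. fold (L x) (L y) in L1.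
pose proof (Lp x ltac:(lra)). pose proof (Lp y ltac:(lra)).
pose proof (Sp x ltac:(lra)). pose proof (Sp y ltac:(lra)).
rewrite (E x), (E y) by lra.
pose proof (gfun_pos x ltac:(lra)). pose proof (gfun_pos y ltac:(lra)).
assert (s y ^ 2 * L y <= s x ^ 2 * L x).
{ apply Rmult_le_compat; [nra | lra | | easy]. apply pow_incr. lra. }
assert (s y + s y ^ 2 * L y < s x + s x ^ 2 * L x) by lra.
assert (0 < gfun x * gfun y) by now apply Rmult_lt_0_compat.
nra.
Qed.

(** * Reduction of the sketch to the two integrals *)

(* At cardinality [lam], the cell of index [k] contributes to the entropy, and to
   [lam ^ 2] times the Fisher information, the following functions of
   [a = lam / q ^ k]. *)
Definition cell (q a : R) : R := exp (- a) - exp (- (q * a)).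
Definition cellH (q a : R) : R := - (cell q a * log2 (cell q a)).
Definition cellI (q a : R) : R :=
  (a * exp (- a) - q * a * exp (- (q * a))) ^ 2 / cell q a.

Lemma powerRZ_ratio (q r : R) (k : Z) : 0 < q ->
  Rpower q r / powerRZ q k = Rpower q (r - IZR k).
Proof.
intros Hq. rewrite powerRZ_Rpower by easy. unfold Rminus.
now rewrite Rpower_plus, Rpower_Ropp.
Qed.

Lemma powerRZ_ratio_pred (q r : R) (k : Z) : 0 < q ->
  Rpower q r / powerRZ q (k - 1) = q * Rpower q (r - IZR k).
Proof.
intros Hq. rewrite powerRZ_ratio, minus_IZR by easy.
replace (r - (IZR k - 1)) with (1 + (r - IZR k)) by ring.
now rewrite Rpower_plus, Rpower_1.
Qed.

Lemma psi_cell (q r : R) (k : Z) : 0 < q ->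
  psi q (Rpower q r) k = cell q (Rpower q (r - IZR k)).
Proof.
intros Hq. unfold psi, cell.
rewrite <- (powerRZ_ratio_pred q r k), <- (powerRZ_ratio q r k) by easy.
unfold Rdiv. now rewrite !Ropp_mult_distr_l.
Qed.

(** The factor [lam] makes the right side depend on [lam] only through [lam / q ^ k]. Squared, it is
    the weight [q ^ (2 r)] in [calI], and the sign disappears. *)
Lemma Derive_psi (q lam : R) (k : Z) : 0 < q ->
  lam * Derive (fun l => psi q l k) lam =
  - (lam / powerRZ q k * exp (- (lam / powerRZ q k)) -
     lam / powerRZ q (k - 1) * exp (- (lam / powerRZ q (k - 1)))).
Proof.
intros Hq. pose proof (powerRZ_lt q k Hq). pose proof (powerRZ_lt q (k - 1) Hq).
unfold psi. set (A := powerRZ q k) in *. set (B := powerRZ q (k - 1)) in *.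
rewrite (is_derive_unique _ lam (- / A * exp (- lam / A) - - / B * exp (- lam / B))).
- unfold Rdiv. rewrite !Ropp_mult_distr_l. ring.
- auto_derive; [easy|]. unfold Rdiv. ring.
Qed.

Lemma Hent_cell (q r : R) : 0 < q ->
  Hent q (Rpower q r) = sumZ (fun k => cellH q (Rpower q (r - IZR k))).
Proof.
intros Hq. unfold Hent, sumZ, cellH.
f_equal; apply Series_ext; intros n; now rewrite psi_cell.
Qed.

Lemma sumZ_scal (c : R) (f : Z -> R) : c * sumZ f = sumZ (fun k => c * f k).
Proof. unfold sumZ. now rewrite Rmult_plus_distr_l, <- !Series_scal_l. Qed.

Lemma Ifish_cell (q r : R) : 0 < q ->
  Rpower q (2 * r) * Ifish q (Rpower q r) =
  sumZ (fun k => cellI q (Rpower q (r - IZR k))).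
Proof.
intros Hq. unfold Ifish. rewrite sumZ_scal.
assert (E : forall k, Rpower q (2 * r) *
    (Derive (fun l => psi q l k) (Rpower q r) ^ 2 / psi q (Rpower q r) k) =
    cellI q (Rpower q (r - IZR k))).
{ intros k. unfold cellI. rewrite <- psi_cell by easy.
  replace (2 * r) with (r + r) by ring. rewrite Rpower_plus.
  rewrite <- (powerRZ_ratio_pred q r k), <- (powerRZ_ratio q r k) by easy.
  assert (D := Derive_psi q (Rpower q r) k Hq).
  set (lam := Rpower q r) in *. set (d := Derive _ _) in *.
  replace (lam * lam * (d ^ 2 / psi q lam k)) with ((lam * d) ^ 2 / psi q lam k)
    by (unfold Rdiv; ring).
  rewrite D. unfold Rdiv. ring. }
unfold sumZ. f_equal; apply Series_ext; intros n; apply E.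
Qed.

Lemma cell_factor (q a : R) :
  exp (- (q * a)) = exp (- a) * exp (- ((q - 1) * a)).
Proof. rewrite <- exp_plus. f_equal. ring. Qed.

(** The rate [1 / (q - 1)] is the one for which damping at [(q - 1) a] gives exactly [exp (- a)]. *)
Lemma damp_cell (q a : R) (phi : R -> R) : 1 < q ->
  damp (/ (q - 1)) phi ((q - 1) * a) = exp (- a) * phi ((q - 1) * a).
Proof. intros Hq. unfold damp. do 2 f_equal. field. lra. Qed.

(** The cell is [exp (- a) * (1 - y)], so its logarithm splits as [- a + ln (1 - y)]; the leftover
    [(q - 1) a exp (- q a)] is the first term of [hexp]. *)
Lemma cellH_decomp (q : R) : 1 < q -> forall a, 0 < a ->
  / ln 2 * ((powexp 0 a + -1 * powexp 0 (q * a)) + damp (/ (q - 1)) hexp ((q - 1) * a)) =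
  cellH q a.
Proof.
intros Hq a Ha. rewrite damp_cell, hexpE by easy. unfold cellH, cell, log2, powexp.
rewrite cell_factor.
assert (Hb : 0 < (q - 1) * a) by (apply Rmult_lt_0_compat; lra).
pose proof (exp_neg_lt1 _ Hb).
set (y := exp (- ((q - 1) * a))) in *.
replace (exp (- a) - exp (- a) * y) with (exp (- a) * (1 - y)) by ring.
rewrite ln_mult, ln_exp by (apply exp_pos || lra).
field. apply Rgt_not_eq. rewrite <- ln_1. apply ln_increasing; lra.
Qed.

(** With [y = exp (- ((q - 1) a))] this is the identity [(1 - q y)^2 = (1 - q^2 y) (1 - y) + (q -
    1)^2 y]. *)
Lemma cellI_decomp (q : R) : 1 < q -> forall a, 0 < a ->
  (powexp 1 a + -1 * powexp 1 (q * a)) + damp (/ (q - 1)) gfun ((q - 1) * a) = cellI q a.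
Proof.
intros Hq a Ha. rewrite damp_cell by easy. unfold gfun, cellI, cell, powexp.
rewrite cell_factor.
assert (Hb : 0 < (q - 1) * a) by (apply Rmult_lt_0_compat; lra).
pose proof (exp_neg_lt1 _ Hb).
replace (exp ((q - 1) * a)) with (/ exp (- ((q - 1) * a)))
  by (rewrite <- exp_Ropp; f_equal; ring).
set (y := exp (- ((q - 1) * a))) in *. pose proof (exp_pos (- a)).
set (x := exp (- a)) in *. field. repeat split; nra.
Qed.

(* The two power terms have equal integrals since the integral is dilation invariant. *)
Lemma Mint_decomp (q : R) (n : nat) (phi : R -> R) : 1 < q -> tame phi ->
  let chi := fun a =>
    (powexp n a + -1 * powexp n (q * a)) + damp (/ (q - 1)) phi ((q - 1) * a) in
  tame chi /\ Mint chi = Mint (damp (/ (q - 1)) phi).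
Proof.
intros Hq H chi. unfold chi.
assert (Hu : 0 <= / (q - 1)) by (left; apply Rinv_0_lt_compat; lra).
assert (T1 : tame (powexp n)) by apply tame_powexp.
assert (T2 : tame (fun a => powexp n (q * a))) by (apply tame_dilate; [lra | easy]).
assert (T3 : tame (fun a => -1 * powexp n (q * a)))
  by now apply (tame_scal _ (fun a => powexp n (q * a))).
assert (T12 : tame (fun a => powexp n a + -1 * powexp n (q * a))) by now apply tame_plus.
assert (T4 : tame (damp (/ (q - 1)) phi)) by now apply tame_damp.
assert (T5 : tame (fun a => damp (/ (q - 1)) phi ((q - 1) * a)))
  by (apply tame_dilate; [lra | easy]).
split; [now apply (tame_plus (fun a => powexp n a + -1 * powexp n (q * a)))|].
rewrite (Mint_plus (fun a => powexp n a + -1 * powexp n (q * a))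
  (fun a => damp (/ (q - 1)) phi ((q - 1) * a))), Mint_plus,
  (Mint_scal _ (fun a => powexp n (q * a))) by easy.
rewrite !Mint_dilate by (lra || easy). ring.
Qed.

Lemma calH_eq (q : R) : 1 < q -> calH q = / ln 2 * Mint (damp (/ (q - 1)) hexp) / ln q.
Proof.
intros Hq. destruct (Mint_decomp q 0 hexp Hq tame_hexp) as [T E].
assert (TH : tame (cellH q)).
{ eapply tame_ext; [exact (cellH_decomp q Hq) | now apply tame_scal]. }
rewrite <- E, <- Mint_scal, <- (Mint_ext _ _ (cellH_decomp q Hq)) by (easy || now apply tame_scal).
rewrite <- RInt_sumZ_geometric by easy.
apply RInt_ext. intros r _. apply Hent_cell. lra.
Qed.

Lemma calI_eq (q : R) : 1 < q -> calI q = Mint (damp (/ (q - 1)) gfun) / ln q.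
Proof.
intros Hq. destruct (Mint_decomp q 1 gfun Hq tame_gfun) as [T E].
assert (TI : tame (cellI q)) by (eapply tame_ext; [exact (cellI_decomp q Hq) | easy]).
rewrite <- E, <- (Mint_ext _ _ (cellI_decomp q Hq)) by easy.
rewrite <- RInt_sumZ_geometric by easy.
apply RInt_ext. intros r _. apply Ifish_cell. lra.
Qed.

Lemma Fish_eq (q : R) : 1 < q ->
  Fish q = / ln 2 * (Mint (damp (/ (q - 1)) hexp) / Mint (damp (/ (q - 1)) gfun)).
Proof.
intros Hq. unfold Fish. rewrite calH_eq, calI_eq by easy.
assert (0 < ln q) by (rewrite <- ln_1; apply ln_increasing; lra).
assert (0 < ln 2) by (rewrite <- ln_1; apply ln_increasing; lra).
assert (0 < Mint (damp (/ (q - 1)) gfun)).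
{ apply Mint_gt0_of_pos.
  - apply tame_damp; [left; apply Rinv_0_lt_compat; lra | apply tame_gfun].
  - intros x Hx. apply Rmult_lt_0_compat; [apply exp_pos | now apply gfun_pos]. }
field. lra.
Qed.

Theorem mainTheorem5 :
  (forall q : R, 1 < q -> Fish q > H0 / I0) /\
  is_lim Fish p_infty (H0 / I0).
Proof.
assert (Hl : 0 < ln 2) by (rewrite <- ln_1; apply ln_increasing; lra).
assert (HI : 0 < I0) by (apply (Mint_gt0_of_pos gfun); [apply tame_gfun | apply gfun_pos]).
(* [H0] and [I0] unfold to [/ ln 2 * Mint hexp] and [Mint gfun], so only associativity is left. *)
assert (E : H0 / I0 = / ln 2 * (Mint hexp / Mint gfun)).
{ unfold Rdiv. rewrite <- Rmult_assoc. reflexivity. }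
rewrite E. split.
- intros q Hq. rewrite Fish_eq by easy.
  apply Rmult_lt_compat_l; [now apply Rinv_0_lt_compat|].
  apply Mint_damp_ratio.
  + apply Rinv_0_lt_compat; lra.
  + apply tame_hexp.
  + apply tame_gfun.
  + apply gfun_pos.
  + apply hexp_gfun_ratio_decr.
- apply (is_lim_ext_loc (fun q => / ln 2 *
    (Mint (damp (/ (q - 1)) hexp) / Mint (damp (/ (q - 1)) gfun)))).
  { exists 1. intros q Hq. now rewrite Fish_eq. }
  apply (is_lim_scal_l _ (/ ln 2) p_infty (Mint hexp / Mint gfun)).
  apply (is_lim_div _ _ p_infty (Mint hexp) (Mint gfun)).
  + apply is_lim_Mint_damp; [apply tame_hexp | apply tame_id_hexp |].
    intros x Hx. left. now apply hexp_pos.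
  + apply is_lim_Mint_damp; [apply tame_gfun | apply tame_id_gfun |].
    intros x Hx. left. now apply gfun_pos.
  + intros Z. injection Z. apply Rgt_not_eq, HI.
  + simpl. trivial.
Qed.
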